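(* For every weak composition $a$, $\mathcal{A}_a=\mathfrak{Q}^{(1)}_a$.
   Context: A weak composition of length $n$ is a sequence of $n$ nonnegative integers. $D(a)$: $a_i$ left-justified boxes in row $i$, row 1 lowest. For a filling $S$, $x^{\mathrm{wt}(S)}=\prod_i x_i^{\#\{\text{entries } i\}}$. Demazure atom: a triple of $D(a)$ (rows $r<s$) is Type A: boxes $\gamma=(r,c),\alpha=(r,c+1),\beta=(s,c+1)$ with $a_r\ge a_s$, or Type B: $\gamma=(s,c),\alpha=(s,c+1),\beta=(r,c)$ with $a_s>a_r$; inversion triple if $\beta>\gamma\ge\alpha$ or $\gamma\ge\alpha>\beta$. $\mathcal{A}_a=\sum x^{\mathrm{wt}(S)}$ over fillings of $D(a)$ with positive integers, rows weakly decreasing left to right, distinct entries in each column, all triples inversion triples, and first-column entry of each nonempty row $i$ equal to $i$. Quasi-key tableau of shape $a$: filling of $D(a)$ with positive integers such that (1) entries weakly decrease along rows and no entry of row $i$ exceeds $i$; (2) entries in each column are distinct and increase going up the first column; (3) if an entry $i$ is above an entry $k$ in the same column with $i<k$, there is an entry $j$ immediately right of $k$ with $i<j$; (4) for two rows with the higher row strictly longer, if $i$ is in column $c$ of the lower row and $j$ in column $c+1$ of the higher row, then $i<j$. $\mathfrak{Q}^{(1)}_a=\sum x^{\mathrm{wt}(T)}$ over quasi-key tableaux $T$ of shape $a$ whose first-column entries equal their row indices. *)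

(* Defs.v *)
From mathcomp Require Import all_boot all_order all_algebra.
From mathcomp Require Import mpoly.
Set Implicit Arguments. Unset Strict Implicit. Unset Printing Implicit Defensive.
Import GRing.Theory.

(* Conventions (everything 0-indexed internally):
   - a weak composition of length n is a : n.-tuple nat; row r : 'I_n is the
     paper's row r+1 (row 1 lowest), and tnth a r is a_{r+1};
   - column c (nat) is the paper's column c+1;
   - an entry e : 'I_n stands for the positive integer e+1, and is weighted by
     the variable 'X_e (the paper's x_{e+1}).  Order comparisons of entries are
     the same as of the integers they stand for.
   - M a = max part of a; a filling is a finite function on 'I_n * 'I_(M a)
     whose values at cells outside D(a) are fixed to value 0 (so fillings of D(a)
     correspond bijectively to such normalized functions). *)

Section Diagrams.
Variable n : nat.
Variable a : n.-tuple nat.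

Definition maxpart : nat := \max_(r < n) tnth a r.

Definition filling := {ffun 'I_n * 'I_maxpart -> 'I_n}.

Definition inD (r : 'I_n) (c : nat) : bool := c < tnth a r.

Definition ent (f : filling) (r : 'I_n) (c : nat) : nat :=
  match insub c with
  | Some c' => val (f (r, c'))
  | None => 0%N
  end.

Definition normalized (f : filling) : bool :=
  [forall rc : 'I_n * 'I_maxpart, ~~ inD rc.1 rc.2 ==> (val (f rc) == 0)].

Definition xwt (f : filling) : {mpoly int[n]} :=
  (\prod_(rc : 'I_n * 'I_maxpart | inD rc.1 rc.2) 'X_(f rc))%R.

(* Columns c range over 'I_maxpart: every box (r,c) of D(a) has c < maxpart,
   so this is no restriction. *)

Definition rows_weakly_decr (f : filling) : bool :=
  [forall r : 'I_n, forall c : 'I_maxpart,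
     inD r c.+1 ==> (ent f r c.+1 <= ent f r c)].

Definition cols_distinct (f : filling) : bool :=
  [forall r : 'I_n, forall s : 'I_n, forall c : 'I_maxpart,
     [&& r != s, inD r c & inD s c] ==> (ent f r c != ent f s c)].

Definition first_col_rowidx (f : filling) : bool :=
  [forall r : 'I_n, inD r 0 ==> (ent f r 0 == val r)].

Definition is_inversion (b g al : nat) : bool :=
  ((g < b) && (al <= g)) || ((b < al) && (al <= g)).

Definition all_triples_inversion (f : filling) : bool :=
  [forall r : 'I_n, forall s : 'I_n, forall c : 'I_maxpart,
    ([&& r < s, tnth a s <= tnth a r, inD r c, inD r c.+1 & inD s c.+1] ==>
       is_inversion (ent f s c.+1) (ent f r c) (ent f r c.+1)) &&
    ([&& r < s, tnth a r < tnth a s, inD s c, inD s c.+1 & inD r c] ==>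
       is_inversion (ent f r c) (ent f s c) (ent f s c.+1))].

Definition atom_filling (f : filling) : bool :=
  [&& normalized f, rows_weakly_decr f, cols_distinct f,
      all_triples_inversion f & first_col_rowidx f].

Definition demazure_atom : {mpoly int[n]} :=
  (\sum_(f : filling | atom_filling f) xwt f)%R.

Definition quasi_key (f : filling) : bool :=
  [&& normalized f,
      rows_weakly_decr f &&
        [forall r : 'I_n, forall c : 'I_maxpart, inD r c ==> (ent f r c <= r)],
      cols_distinct f &&
        [forall r : 'I_n, forall s : 'I_n,
           [&& r < s, inD r 0 & inD s 0] ==> (ent f r 0 < ent f s 0)],
      [forall r : 'I_n, forall s : 'I_n, forall c : 'I_maxpart,
         [&& r < s, inD r c, inD s c & ent f s c < ent f r c] ==>
           (inD r c.+1 && (ent f s c < ent f r c.+1))] &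
      [forall r : 'I_n, forall s : 'I_n, forall c : 'I_maxpart,
         [&& r < s, tnth a r < tnth a s, inD r c & inD s c.+1] ==>
           (ent f r c < ent f s c.+1)]].

Definition quasikey1 : {mpoly int[n]} :=
  (\sum_(f : filling | quasi_key f && first_col_rowidx f) xwt f)%R.

End Diagrams.

(* Main.v *)
Require Import Defs.
From mathcomp Require Import all_boot all_order all_algebra perm.
From mathcomp Require Import mpoly zify.
Set Implicit Arguments. Unset Strict Implicit. Unset Printing Implicit Defensive.

(** Fix a set of entries for each column, and consider all fillings, of any
shape, with these columns, decreasing rows and first-column entries equal to
their row indices. If there is one, then exactly one of them is an atom filling
and exactly one is a quasi-key filling, and these two have the same shape.
Read from left to right, the atom condition says that each row, lowest row first,
takes the largest available entry that fits; read from right to left, the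
quasi-key condition says that each row, longest row first and lowest first among
rows of equal length, takes the smallest available entry that fits. Comparing
with an arbitrary filling of the family, the first greedy choice maximizes the
entries of the lowest [k] rows, and the second minimizes the entries of any
initial segment of the row order. Applied to one another, these two extremal
properties force the same shape; each also gives uniqueness. A filling of either
kind is reached from any member of the family by exchanging the tails of two
rows, one column at a time. *)

(** * Fillings of arbitrary shape, encoded as chains *)

Section Chains.
Variables n m : nat.
Implicit Types (f g h : 'I_n -> nat -> nat) (r s q : 'I_n) (I J : pred 'I_n).

(* [h r c] is [e.+1] if the box (r, c) carries the entry [e], and [0] if there is
   no such box: the shape is part of [h], and an absent box compares as smaller
   than every entry. *)
Record chains h : Prop := Chains {
  chains_decr : forall r c, h r c.+1 <= h r c;
  chains_inj : forall r s c, 0 < h r c -> h r c = h s c -> r = s;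
  chains_first : forall r, 0 < h r 0 -> h r 0 = r.+1;
  chains_end : forall r c, m <= c -> h r c = 0 }.

Definition same_cols f h := forall c,
  perm_eq [seq f r c | r <- enum 'I_n] [seq h r c | r <- enum 'I_n].

Lemma same_cols_sym f h : same_cols f h -> same_cols h f.
Proof. by move=> fh c; rewrite perm_sym. Qed.

Lemma same_cols_trans g f h : same_cols f g -> same_cols g h -> same_cols f h.
Proof. by move=> fg gh c; apply: perm_trans (fg c) (gh c). Qed.

Lemma same_cols_big f h (R : Type) (idx : R) (op : Monoid.com_law idx)
    (F : nat -> R) c : same_cols f h ->
  \big[op/idx]_r F (f r c) = \big[op/idx]_r F (h r c).
Proof.
move=> /(_ c) fh.
rewrite -[LHS]big_enum -[RHS]big_enum /=.
rewrite -(big_map (f^~ c) predT F) -(big_map (h^~ c) predT F).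
exact: perm_big.
Qed.

Lemma chains_le h r c d : chains h -> c <= d -> h r d <= h r c.
Proof.
move=> hC /subnK <-; elim: (d - c) => [|e IH] //.
by rewrite addSn (leq_trans (chains_decr hC _ _)).
Qed.

Lemma chains_row h r c : chains h -> h r c <= r.+1.
Proof.
move=> hC; have := chains_le r hC (leq0n c).
have := chains_first hC (r := r); lia.
Qed.

Lemma chains_bound h r c : chains h -> h r c <= n.
Proof. by move=> hC; have := chains_row r c hC; have := ltn_ord r; lia. Qed.

(** A positive first-column entry names its own row, so the set of these entries fixes their
    positions. *)
Lemma same_cols_first f h r :
  chains f -> chains h -> same_cols f h -> f r 0 = h r 0.
Proof.
wlog: f h / h r 0 <= f r 0.
  move=> W fC hC fh; case: (leqP (h r 0) (f r 0)) => [|/ltnW] le.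
    exact: W.
  by apply/esym/W => //; exact: same_cols_sym.
move=> le fC hC fh; have [fr0|fr0] := posnP (f r 0); first by lia.
have: \sum_q (h q 0 == f r 0) = \sum_q (f q 0 == f r 0).
  by rewrite (same_cols_big addn (fun x => nat_of_bool (x == f r 0)) 0 fh).
rewrite [RHS](bigD1 r) //= eqxx => E.
have: \sum_q (h q 0 == f r 0) != 0 by rewrite E.
rewrite sum_nat_eq0 negb_forall => /existsP[q /=].
rewrite eqb0 negbK => /eqP hq.
have := chains_first hC (r := q); rewrite hq (chains_first fC) // => /(_ isT) [].
by move=> /val_inj rq; rewrite -(chains_first fC) // -hq rq.
Qed.

(* Both types of triples at once: once row [s] drops below a lower row [r], it
   stays below, so [s] cannot be the longer row. *)
Definition atomic h := forall r s c, r < s -> 0 < h s c.+1 ->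
  h r c < h s c.+1 \/ h s c.+1 < h r c.+1.

(** * Extremal properties, by counting entries above a threshold *)

Lemma sum_lt_split I (u : 'I_n -> nat) t :
  \sum_(r | I r) (t < u r) =
  \sum_(r | I r) (u r == t.+1) + \sum_(r | I r) (t.+1 < u r).
Proof.
by rewrite -big_split; apply: eq_bigr => r _ /=; case: ltngtP => //; lia.
Qed.

Lemma sum_eq_sub I (u : 'I_n -> nat) v :
  \sum_(r | I r) (u r == v) <= \sum_r (u r == v).
Proof. by rewrite [leqRHS](bigID I) leq_addr. Qed.

Lemma sum_eq_full I (u : 'I_n -> nat) v :
  (forall s, u s = v -> I s) ->
  \sum_(r | I r) (u r == v) = \sum_r (u r == v).
Proof.
move=> uI; rewrite [RHS](bigID I) /= [X in _ + X]big1 ?addn0 // => r nI.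
by case: eqP => // /uI; rewrite (negPf nI).
Qed.

Lemma same_cols_count f h v c : same_cols f h ->
  \sum_r (f r c == v) = \sum_r (h r c == v).
Proof. exact: (same_cols_big addn (fun x => nat_of_bool (x == v))). Qed.

(** Induction on the column from the left, then on [t] downwards from [n]. If [f] has no [t.+1]
    outside the first [k] rows, lowering the threshold from [t.+1] to [t] gains at least as much for
    [f] as for [h]. *)
Lemma atomic_dominates f h k c t :
  chains f -> chains h -> atomic f -> same_cols f h ->
  \sum_(r : 'I_n | r < k) (t < h r c) <= \sum_(r : 'I_n | r < k) (t < f r c).
Proof.
move=> fC hC fA fh; elim: c t => [|c IHc] t.
  by apply: leq_sum => r _; rewrite (same_cols_first r fC hC fh).
have [d] := ubnP (n - t); elim: d t => // d IHd t lt_d.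
have [le_nt|lt_tn] := leqP n t.
  rewrite big1 // => r _.
  by have := chains_bound r c.+1 hC; case: ltnP => //; lia.
(* A value [t.+1] placed by [f] above the first [k] rows does not separate their
   entries in columns [c] and [c.+1]. *)
have [/existsP[s /andP[ks /eqP fs]]|nex] :=
    boolP [exists s : 'I_n, (k <= s) && (f s c.+1 == t.+1)].
  have -> : \sum_(r : 'I_n | r < k) (t < f r c.+1) =
            \sum_(r : 'I_n | r < k) (t < f r c).
    apply: eq_bigr => r rk.
    have := fA r s c (leq_trans rk ks); rewrite fs => /(_ isT).
    have := chains_decr fC r c; lia.
  apply: leq_trans (IHc t); apply: leq_sum => r _.
  have := chains_decr hC r c; lia.
rewrite [leqLHS]sum_lt_split [leqRHS]sum_lt_split leq_add //; last by apply: IHd; lia.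
rewrite (leq_trans (sum_eq_sub _ _ _)) // -(same_cols_count _ _ fh) [leqRHS]sum_eq_full //.
move=> s fs; rewrite ltnNge; apply: contra nex => ks.
by apply/existsP; exists s; rewrite ks fs /=.
Qed.

(** The mirror image: columns from the right, then [t] upwards. An entry [t.+1] of [g] outside [I]
    reduces column [c] to [c.+1]; otherwise raising the threshold loses at least as much for [g] as
    for [h]. Separate [I] and [J] allow for different shapes. *)
Lemma initial_minimal g h I J c t :
  chains g -> chains h -> same_cols g h ->
  (forall r s d, I r -> ~~ I s -> 0 < g s d ->
     g r d < g s d \/ g s d < g r d.+1) ->
  (forall d, \sum_(r | I r) (0 < g r d) <= \sum_(r | J r) (0 < h r d)) ->
  \sum_(r | I r) (t < g r c) <= \sum_(r | J r) (t < h r c).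
Proof.
move=> gC hC gh gI g0.
have [d] := ubnP (m - c); elim: d c t => // d IHd c t lt_d.
have [le_mc|lt_cm] := leqP m c.
  by rewrite big1 // => r _; rewrite (chains_end gC).
elim: t => [|t IHt]; first exact: g0.
have [/existsP[s /andP[nIs /eqP gs]]|nex] :=
    boolP [exists s : 'I_n, ~~ I s && (g s c == t.+1)].
  have -> : \sum_(r | I r) (t.+1 < g r c) = \sum_(r | I r) (t.+1 < g r c.+1).
    apply: eq_bigr => r Ir.
    have := gI r s c Ir nIs; rewrite gs => /(_ isT).
    have := chains_decr gC r c; lia.
  have lt' : m - c.+1 < d by lia.
  apply: leq_trans (IHd c.+1 t.+1 lt') _; apply: leq_sum => r _.
  have := chains_decr hC r c; lia.
move: IHt; rewrite [leqLHS]sum_lt_split [leqRHS]sum_lt_split.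
have -> : \sum_(r | I r) (g r c == t.+1) = \sum_r (h r c == t.+1).
  rewrite -(same_cols_count _ _ gh) sum_eq_full //.
  move=> s gs; apply: contraR nex => nIs.
  by apply/existsP; exists s; rewrite nIs gs /=.
have := sum_eq_sub J (h^~ c) t.+1; lia.
Qed.

Lemma chains_eq2 f h : f =2 h -> chains h -> chains f.
Proof.
move=> fh [h1 h2 h3 h4]; split.
- by move=> r c; rewrite !fh.
- by move=> r s c; rewrite !fh; apply: h2.
- by move=> r; rewrite !fh; apply: h3.
- by move=> r c; rewrite !fh; apply: h4.
Qed.

(** * Existence by exchanging tails *)

Definition swap_tails r s k h : 'I_n -> nat -> nat :=
  fun q c => if k <= c then h (tperm r s q) c else h q c.

Lemma same_cols_swap r s k h : same_cols (swap_tails r s k h) h.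
Proof.
move=> c; rewrite /swap_tails; case: (k <= c) => //.
rewrite (map_comp (h^~ c)); apply: perm_map.
apply: uniq_perm; rewrite ?(map_inj_uniq perm_inj) ?enum_uniq // => q.
rewrite mem_enum inE; apply/mapP; exists (tperm r s q); rewrite ?mem_enum //.
by rewrite tpermK.
Qed.

Lemma chains_swap r s k h : chains h ->
  h s k.+1 <= h r k -> h r k.+1 <= h s k ->
  chains (swap_tails r s k.+1 h).
Proof.
move=> hC sr rs; split; rewrite /swap_tails.
- move=> q c; rewrite ltnS; case: (ltngtP k c) => [_|_|<-]; try exact: chains_decr.
  by case: tpermP => [->|->|_ _] //; apply: chains_decr.
- move=> q q' c; case: ifP => _ h0 eq; last exact: chains_inj eq.
  by apply: (@perm_inj _ (tperm r s)); apply: chains_inj eq.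
- by move=> q /=; apply: chains_first.
- by move=> q c le; case: ifP => _; apply: chains_end.
Qed.

(** The rearrangement inequality for one transposition; it makes both exchange procedures
    terminate. *)
Lemma swap_rearrange (u v : 'I_n -> nat) r s :
  u s < u r -> v s < v r ->
  \sum_q u q * v (tperm r s q) < \sum_q u q * v q.
Proof.
move=> us vs; have rs : s != r by apply: contraTneq us => ->; rewrite ltnn.
rewrite (bigD1 r) //= (bigD1 s) //= [ltnRHS](bigD1 r) //= [in ltnRHS](bigD1 s) //=.
rewrite tpermL tpermR !addnA.
have -> : \sum_(i < n | (i != r) && (i != s)) u i * v (tperm r s i) =
          \sum_(i < n | (i != r) && (i != s)) u i * v i.
  by apply: eq_bigr => q /andP[qr qs]; rewrite tpermD // eq_sym.
by rewrite ltn_add2r; nia.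
Qed.

Lemma atomic_exists h : chains h ->
  exists f, [/\ chains f, same_cols f h & atomic f].
Proof.
move=> hC.
suff [f [fC fh fA]] : exists f, [/\ chains f, same_cols f h &
    forall r s c, c < m -> r < s -> 0 < f s c.+1 ->
      f r c < f s c.+1 \/ f s c.+1 < f r c.+1].
  exists f; split=> // r s c; case: (ltnP c m) => [|mc]; first exact: fA.
  by rewrite (chains_end fC s) //; lia.
elim: {1}m => [|k [f [fC fh fA]]]; first by exists h; split.
(* Columns up to [k] stay intact. Each exchange puts the larger entry of column [k.+1] into the
   lower row, which lowers this sum. *)
have [p] := ubnP (\sum_(q < n) q * f q k.+1).
elim: p f fC fh fA => // p IHp f fC fh fA lt_p.
have [/existsP[r /existsP[s /and4P[rs s0 sr rs1]]]|nex] :=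
    boolP [exists r : 'I_n, exists s : 'I_n,
      [&& r < s, 0 < f s k.+1, f s k.+1 <= f r k & f r k.+1 <= f s k.+1]].
  have lt_rs : f r k.+1 < f s k.+1.
    rewrite ltn_neqAle rs1 andbT; apply/eqP => eq.
    by move: rs; rewrite -(chains_inj fC s0 (esym eq)) ltnn.
  apply: (IHp (swap_tails r s k.+1 f)).
  - apply: chains_swap => //; apply: leq_trans rs1 (chains_decr fC _ _).
  - exact: same_cols_trans (same_cols_swap _ _ _ _) fh.
  - move=> q q' c ck; rewrite /swap_tails.
    have -> : (k < c.+1) = false by lia.
    have -> : (k < c) = false by lia.
    exact: fA.
  - apply: leq_trans _ (ltnSE lt_p); rewrite /swap_tails leqnn tpermC.
    exact: (@swap_rearrange val (f^~ k.+1)).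
exists f; split=> // r s c; rewrite ltnS leq_eqVlt => /orP[/eqP->|]; last exact: fA.
move=> rs s0; move: nex; rewrite negb_exists => /forallP/(_ r).
rewrite negb_exists => /forallP/(_ s); rewrite rs s0 /=; lia.
Qed.

Definition tail_len h r c := \sum_(d < m) (0 < h r (c.+1 + d)).

(* Orders the rows by length, then by decreasing next entry. Unlike the row
   index, this tie-break only depends on the columns to the right of [c], so it
   moves along with an exchanged tail. *)
Definition tail_key h r c := tail_len h r c * n.+1 + (n - h r c.+1).

Definition quasi_at h c := forall r s, tail_key h s c < tail_key h r c ->
  0 < h s c -> h r c < h s c \/ h s c < h r c.+1.

Lemma quasi_at_exists h : chains h ->
  exists g, [/\ chains g, same_cols g h & forall c, quasi_at g c].
Proof.
move=> hC.
suff [k k0 [g [gC gh gQ]]] : exists2 k, k = 0 & exists g,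
    [/\ chains g, same_cols g h & forall c, k <= c -> quasi_at g c].
  by exists g; split=> // c; apply: gQ; rewrite k0.
(* Columns are corrected from right to left: after [j] rounds, those from [m - j] on are done. *)
exists (m - m); first by rewrite subnn.
elim: {2}m => [|j [g [gC gh gQ]]].
  exists h; split=> // c; rewrite subn0 => mc r s _.
  by rewrite (chains_end hC).
have [lt_jm|le_mj] := ltnP j m; last first.
  by exists g; split=> // c; rewrite (_ : m - j.+1 = m - j) //; [exact: gQ | lia].
have Ek : m - j = (m - j.+1).+1 by lia.
move: (m - j.+1) Ek => k Ek; rewrite {}Ek in gQ.
(* Each exchange attaches the tail with the smaller key to the larger entry of column [k], which
   lowers this sum. *)
have [p] := ubnP (\sum_(q < n) g q k * tail_key g q k).
elim: p g gC gh gQ => // p IHp g gC gh gQ lt_p.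
have [/existsP[r /existsP[s /and4P[key s0 sr rs1]]]|nex] :=
    boolP [exists r : 'I_n, exists s : 'I_n,
      [&& tail_key g s k < tail_key g r k, 0 < g s k, g s k <= g r k &
          g r k.+1 <= g s k]].
  have lt_sr : g s k < g r k.
    rewrite ltn_neqAle sr andbT; apply/eqP => eq.
    by move: key; rewrite -(chains_inj gC s0 eq) ltnn.
  (* Keys move along with the tails, so the condition in later columns is merely permuted. *)
  have keyE q c : k <= c ->
    tail_key (swap_tails r s k.+1 g) q c = tail_key g (tperm r s q) c.
    move=> kc; rewrite /tail_key /tail_len /swap_tails ltnS kc; congr (_ * _ + _).
    by apply: eq_bigr => d _; rewrite ifT //; lia.
  apply: (IHp (swap_tails r s k.+1 g)).
  - apply: chains_swap => //.
    exact: leq_trans (chains_decr gC _ _) sr.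
  - exact: same_cols_trans (same_cols_swap _ _ _ _) gh.
  - move=> c kc q q'; have kc' := ltnW kc.
    rewrite !keyE // /swap_tails ltnS kc kc'; exact: gQ.
  - apply: leq_trans _ (ltnSE lt_p).
    have -> : \sum_(q < n) swap_tails r s k.+1 g q k *
                tail_key (swap_tails r s k.+1 g) q k =
              \sum_(q < n) g q k * tail_key g (tperm r s q) k.
      by apply: eq_bigr => q _; rewrite keyE // /swap_tails ltnn.
    exact: (@swap_rearrange (g^~ k) (tail_key g ^~ k)).
exists g; split=> // c; rewrite leq_eqVlt => /orP[/eqP<-|]; last exact: gQ.
move=> r s key s0; move: nex; rewrite negb_exists => /forallP/(_ r).
rewrite negb_exists => /forallP/(_ s); rewrite key s0 /=; lia.
Qed.

(** * Shapes, and the quasi-key condition in terms of row lengths *)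

Definition shaped (a : 'I_n -> nat) h := forall r c, (0 < h r c) = (c < a r).

Definition precedes (a : 'I_n -> nat) r s :=
  (a s < a r) || (a r == a s) && (r < s).

Definition quasi_atomic a h := forall r s c, precedes a r s -> 0 < h s c ->
  h r c < h s c \/ h s c < h r c.+1.

Lemma sum_antitone (p : pred nat) k :
  (forall c, p c.+1 -> p c) -> (forall c, k <= c -> ~~ p c) ->
  forall c, p c = (c < \sum_(d < k) p d).
Proof.
move=> p_anti p_end.
have p_le c d : c <= d -> p d -> p c.
  by move=> /subnK <-; elim: (d - c) => // e IH; rewrite addSn => /p_anti.
elim: k p_end => [|k IHk] p_end c; first by rewrite big_ord0 (negPf (p_end c _)).
rewrite big_ord_recr /=; case pk: (p k).
  have -> : \sum_(d < k) p d = k.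
    rewrite -[RHS]card_ord -sum1_card; apply: eq_bigr => d _.
    by rewrite (p_le d k) // ltnW.
  rewrite addn1; case: (leqP c k) => [/p_le-> //|kc].
  by rewrite ltnS leqNgt kc (negPf (p_end _ _)).
rewrite addn0; apply: IHk => d; rewrite leq_eqVlt => /orP[/eqP<-|]; first by rewrite pk.
exact: p_end.
Qed.

Lemma shaped_exists h : chains h -> exists a, shaped a h.
Proof.
move=> hC; exists (fun r => \sum_(d < m) (0 < h r d)) => r c.
apply: (sum_antitone (p := fun c => 0 < h r c)) => {}c.
  by move=> h0; apply: leq_trans h0 (chains_decr hC _ _).
by move/(chains_end hC r)->.
Qed.

Lemma tail_lenE a h r c : chains h -> shaped a h -> tail_len h r c = a r - c.+1.
Proof.
move=> hC ha; have E d : (c.+1 + d < a r) = (d < tail_len h r c).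
  rewrite -ha; apply: (sum_antitone (p := fun d => 0 < h r (c.+1 + d))) => e.
    by move=> h0; apply: leq_trans h0 _; rewrite addnS (chains_decr hC).
  by move=> me; rewrite (chains_end hC) // -[m]add0n leq_add.
have := E (tail_len h r c); have := E (a r - c.+1); lia.
Qed.

(** The tie-break by next entry agrees with the row index: rows of equal length start in index
    order, and if they crossed between columns [c] and [c.+1], [quasi_at g c] would contradict their
    order in column [c] or the decrease along rows. *)
Lemma quasi_at_atomic a g : chains g -> shaped a g ->
  (forall c, quasi_at g c) -> quasi_atomic a g.
Proof.
move=> gC ga gQ r s c /orP[lt_a|/andP[/eqP eq_a rs]] s0.
  apply: (gQ c) => //; rewrite /tail_key !(tail_lenE _ _ gC ga).
  have := s0; rewrite ga; nia.
left; elim: c s0 => [|c IHc] s0.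
  have r0 : 0 < g r 0 by rewrite ga eq_a -ga.
  by rewrite (chains_first gC r0) (chains_first gC s0) ltnS.
have s0' : 0 < g s c by apply: leq_trans s0 (chains_decr gC _ _).
have lt_rs := IHc s0'.
case: (ltngtP (g r c.+1) (g s c.+1)) => // [lt_sr|eq]; last first.
  have r0 : 0 < g r c.+1 by rewrite eq.
  by move: rs; rewrite (chains_inj gC r0 eq) ltnn.
have r0 : 0 < g r c.+1 by lia.
have := gQ c s r; rewrite /tail_key !(tail_lenE _ _ gC ga) eq_a.
have := chains_bound r c.+1 gC; have := chains_decr gC r c; lia.
Qed.

(** * Uniqueness and agreement of shapes *)

Lemma sum_prefix_inj (u v : pred 'I_n) :
  (forall k, \sum_(r < n | r < k) u r = \sum_(r < n | r < k) v r) -> u =1 v.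
Proof.
move=> uv r; have := uv r.+1; rewrite (bigD1 r) //= [RHS](bigD1 r) //=.
have E (w : pred 'I_n) :
    \sum_(q < n | (q < r.+1) && (q != r)) w q = \sum_(q < n | q < r) w q.
  by apply: eq_bigl => q; rewrite ltnS ltn_neqAle andbC -val_eqE.
by rewrite !E uv => /addIn; case: (u r) (v r) => [] [].
Qed.

Lemma atomic_unique f h : chains f -> chains h -> atomic f -> atomic h ->
  same_cols f h -> f =2 h.
Proof.
move=> fC hC fA hA fh r c.
have E t : (t < f r c) = (t < h r c).
  apply: (sum_prefix_inj (u := fun r => t < f r c) (v := fun r => t < h r c)) => k.
  apply/eqP; rewrite eqn_leq !atomic_dominates //; exact: same_cols_sym.
have := E (f r c); have := E (h r c); lia.
Qed.

Lemma quasi_atomic_unique a g h : chains g -> chains h ->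
  shaped a g -> shaped a h -> quasi_atomic a g -> quasi_atomic a h ->
  same_cols g h -> g =2 h.
Proof.
move=> gC hC ga ha gQ hQ gh r c.
have E I t : (forall q s, I q -> ~~ I s -> precedes a q s) ->
    \sum_(q | I q) (t < g q c) = \sum_(q | I q) (t < h q c).
  move=> I_ini; apply/eqP; rewrite eqn_leq !initial_minimal //.
  - exact: same_cols_sym.
  - by move=> q s d Iq Is; apply/hQ/I_ini.
  - by move=> d; apply: leq_sum => q _; rewrite ga ha.
  - by move=> q s d Iq Is; apply/gQ/I_ini.
  - by move=> d; apply: leq_sum => q _; rewrite ga ha.
(* Two initial segments differing only in [r] isolate row [r]. *)
have {}E t : (t < g r c) = (t < h r c).
  have := E (fun q => precedes a q r || (q == r)) t.
  rewrite (bigD1 r) ?eqxx ?orbT //= [in RHS](bigD1 r) ?eqxx ?orbT //=.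
  have E1 (w : 'I_n -> nat) :
      \sum_(q | (precedes a q r || (q == r)) && (q != r)) w q =
      \sum_(q | precedes a q r) w q.
    apply: eq_bigl => q; have [->|_] := eqVneq q r; last by rewrite orbF andbT.
    by rewrite andbF /precedes ltnn; lia.
  rewrite !E1 (E (precedes a ^~ r)); last by move=> q s; rewrite /precedes; lia.
  have I_ini q s : precedes a q r || (q == r) ->
      ~~ (precedes a s r || (s == r)) -> precedes a q s.
    rewrite orbC negb_or -[s == r]val_eqE /=.
    by have [->|_] := eqVneq q r; rewrite /precedes; lia.
  by move/(_ I_ini)/addIn; do 2 case: (_ < _).
have := E (g r c); have := E (h r c); lia.
Qed.

(** Compare the boxes of column [c] in the lowest [k] rows. [atomic_dominates] at threshold 0 gives
    one inequality. The other is [initial_minimal] for the rows reaching column [c], read in the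
    first column, where an entry above [k] means a row outside the lowest [k]. *)
Lemma shape_agree b f g : chains f -> chains g -> atomic f -> shaped b g ->
  quasi_atomic b g -> same_cols f g -> forall r c, (0 < f r c) = (0 < g r c).
Proof.
move=> fC gC fA gb gQ fg r c.
apply: (sum_prefix_inj (u := fun r => 0 < f r c) (v := fun r => 0 < g r c)) => k.
apply/eqP; rewrite eqn_leq [X in _ && X]atomic_dominates // andbT.
have pos d : \sum_q (0 < f q d) = \sum_q (0 < g q d).
  exact: (same_cols_big addn (fun x => nat_of_bool (0 < x))).
have high h : chains h -> \sum_(q < n | ~~ (q < k)) (0 < h q c) =
    \sum_(q | 0 < h q c) (k < h q 0).
  move=> hC; rewrite big_mkcond [RHS]big_mkcond; apply: eq_bigr => q _ /=.
  have [_|q0] := posnP (h q c); first by rewrite if_same.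
  have q0' := leq_trans q0 (chains_le q hC (leq0n c)).
  by rewrite (chains_first hC q0') ltnS; case: leqP.
have both h d : chains h ->
    \sum_(q | 0 < h q c) (0 < h q d) = \sum_q (0 < h q (maxn c d)).
  move=> hC; rewrite big_mkcond; apply: eq_bigr => q _.
  case: (leqP c d) => [cd|/ltnW cd]; have := chains_le q hC cd;
    by case: (h q c) (h q d) => [|x] [|y].
have := pos c; rewrite (bigID (fun q : 'I_n => q < k)) /= high //.
rewrite [RHS](bigID (fun q : 'I_n => q < k)) /= high //.
have: \sum_(q | 0 < g q c) (k < g q 0) <= \sum_(q | 0 < f q c) (k < f q 0).
  apply: initial_minimal => //; first exact: same_cols_sym.
    move=> q s d q0 s0; apply: gQ; move: q0 s0; rewrite !gb.
    by rewrite /precedes; lia.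
  by move=> d; rewrite !both // pos.
move=> le_gf eq_fg.
by rewrite -(leq_add2r (\sum_(q | 0 < g q c) (k < g q 0))) -eq_fg leq_add2l.
Qed.

End Chains.

(** * Translation between fillings and chains *)

Section Encoding.
Variables (n : nat) (a : n.-tuple nat).
Local Notation m := (maxpart a).
Implicit Types (f g : filling a) (r s : 'I_n).

Definition enc f r c := if inD a r c then (ent f r c).+1 else 0.

Lemma enc_shaped f : shaped (tnth a) (enc f).
Proof. by move=> r c; rewrite /enc /inD; case: ifP. Qed.

Lemma inD_maxpart r c : inD a r c -> c < m.
Proof. by move=> rc; apply: leq_trans rc (leq_bigmax r). Qed.

Lemma inD_pred r c : inD a r c.+1 -> inD a r c.
Proof. exact: ltnW. Qed.

Lemma enc_in f r c : inD a r c -> enc f r c = (ent f r c).+1.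
Proof. by rewrite /enc => ->. Qed.

Lemma enc_out f r c : ~~ inD a r c -> enc f r c = 0.
Proof. by rewrite /enc => /negPf->. Qed.

Lemma enc_gt0 f r c : (0 < enc f r c) = inD a r c.
Proof. by rewrite /enc; case: ifP. Qed.

Lemma enc_chains f :
  rows_weakly_decr f -> cols_distinct f -> first_col_rowidx f ->
  chains m (enc f).
Proof.
move=> /'forall_forallP fR /'forall_'forall_forallP fD /forallP fF; split.
- move=> r c; have [rc|/enc_out-> //] := boolP (inD a r c.+1).
  have rc' := inD_pred rc; rewrite !enc_in // ltnS.
  exact: implyP (fR r (Ordinal (inD_maxpart rc'))) rc.
- move=> r s c; rewrite enc_gt0 => rc eq.
  have sc : inD a s c by rewrite -(enc_gt0 f) -eq enc_gt0.
  apply/eqP; apply: contraTT (fD r s (Ordinal (inD_maxpart rc))) => rs.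
  by move: eq; rewrite !enc_in // rs rc sc => - [->]; rewrite eqxx.
- move=> r; rewrite enc_gt0 => r0; rewrite enc_in //; congr _.+1.
  exact/eqP/(implyP (fF r)).
- move=> r c mc; apply: enc_out; apply: contraL mc => /inD_maxpart.
  by rewrite ltnNge.
Qed.

Lemma chains_enc f : chains m (enc f) ->
  [/\ rows_weakly_decr f, cols_distinct f & first_col_rowidx f].
Proof.
move=> fC; split.
- apply/'forall_forallP => r c; apply/implyP => rc.
  have := chains_decr fC r c; rewrite !enc_in //; exact: inD_pred.
- apply/'forall_'forall_forallP => r s c; apply/implyP => /and3P[rs rc sc].
  apply: contra rs => /eqP eq; apply/eqP.
  by apply: (chains_inj fC (c := c)); rewrite !enc_in // eq.
- apply/forallP => r; apply/implyP => r0.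
  by have := chains_first fC (r := r); rewrite !enc_in // => /(_ isT) [->].
Qed.

Lemma atom_filling_enc f : atom_filling f ->
  chains m (enc f) /\ atomic (enc f).
Proof.
case/and5P=> _ fR fD fT fF; have fC := enc_chains fR fD fF; split=> //.
move: fT => /'forall_'forall_forallP fT r s c rs.
rewrite enc_gt0 => sc1; have sc := inD_pred sc1.
have [rc|nrc] := boolP (inD a r c); last by left; rewrite enc_out // enc_gt0.
case: (leqP (tnth a s) (tnth a r)) => [le_sr|lt_rs].
  have rc1 : inD a r c.+1 by apply: leq_trans sc1 le_sr.
  have /andP[/implyP T _] := fT r s (Ordinal (inD_maxpart rc)).
  move: T; rewrite /= rs le_sr rc rc1 sc1 => /(_ isT).
  by rewrite !enc_in // /is_inversion; lia.
(* Type B: the longer row [s] starts with the larger entry, and each triple carries this to the next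
   column. *)
left; elim: c sc1 sc rc => [|c IHc] sc1 sc rc.
  have /andP[_ /implyP T] := fT r s (Ordinal (inD_maxpart rc)).
  move: T; rewrite /= rs lt_rs rc sc sc1 => /(_ isT).
  have := chains_first fC (r := r); have := chains_first fC (r := s).
  rewrite !enc_gt0 !enc_in // /is_inversion; lia.
have /andP[_ /implyP T] := fT r s (Ordinal (inD_maxpart rc)).
move: T; rewrite /= rs lt_rs rc sc sc1 => /(_ isT).
have := IHc sc (inD_pred sc) (inD_pred rc); have := chains_decr fC r c.
have := inD_pred rc.
rewrite !enc_in ?(inD_pred rc) // /is_inversion; lia.
Qed.

Lemma atomic_crossed (h : 'I_n -> nat -> nat) r s c d :
  chains m h -> atomic h -> r < s -> h s c < h r c -> c <= d ->
  0 < h s d -> h s d < h r d.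
Proof.
move=> hC hA rs lt_c /subnK <-; elim: (d - c) => [|e IHe]; rewrite ?addSn // => s0.
have := IHe (leq_trans s0 (chains_decr hC _ _)).
have := hA r s _ rs s0; have := chains_decr hC s (e + c); lia.
Qed.

Lemma atomic_filling f : normalized f -> chains m (enc f) -> atomic (enc f) ->
  atom_filling f.
Proof.
move=> fN fC fA; have [fR fD fF] := chains_enc fC.
apply/and5P; split=> //; apply/'forall_'forall_forallP => r s c; apply/andP; split.
  apply/implyP => /and5P[rs le_sr rc rc1 sc1].
  have := fA r s c rs; have := chains_decr fC r c.
  by rewrite enc_gt0 !enc_in // /is_inversion => ? /(_ sc1); lia.
apply/implyP => /and5P[rs lt_rs sc sc1 rc].
have := fA r s c rs; have := chains_decr fC s c.
rewrite enc_gt0 => decr /(_ sc1) [lt|lt].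
  by move: lt decr; rewrite !enc_in // /is_inversion; lia.
have rc1 : inD a r c.+1 by rewrite -(enc_gt0 f) (leq_ltn_trans _ lt).
(* Applied in column [tnth a r], just past the end of row [r], where [s] still has a box. *)
have := atomic_crossed fC fA rs lt (ltnW rc1).
by rewrite enc_gt0 (enc_out f (r := r)) /inD ?ltnn // => /(_ lt_rs).
Qed.

Lemma quasi_key_enc f : quasi_key f && first_col_rowidx f ->
  chains m (enc f) /\ quasi_atomic (tnth a) (enc f).
Proof.
case/andP=> /and5P[_ /andP[fR _] /andP[fD _] f3 f4] fF.
have fC := enc_chains fR fD fF; split=> //.
move: f3 f4 => /'forall_'forall_forallP f3 /'forall_'forall_forallP f4 r s c.
rewrite /precedes enc_gt0 => prec sc.
have rc : inD a r c by move: prec sc; rewrite /inD; lia.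
have /implyP := f3 r s (Ordinal (inD_maxpart sc)).
have /implyP := f4 s r (Ordinal (inD_maxpart sc)) => /= T4 T3.
(* Condition (3) handles a preceding row that is lower; one that is higher is strictly longer, and
   (4) applies. *)
have [rs|sr] := ltnP r s.
  move: T3; rewrite rs rc sc !(enc_in f rc) !(enc_in f sc) /= => T3.
  have [/T3/andP[rc1 lt]|le] := ltnP (ent f s c) (ent f r c).
    by right; rewrite enc_in.
  left; rewrite ltnS ltn_neqAle le andbT; apply/eqP => eq.
  have := chains_inj fC (r := r) (s := s) (c := c).
  by rewrite !enc_in // eq => /(_ isT erefl) ers; rewrite ers ltnn in rs.
right; have lt_sr : tnth a s < tnth a r by lia.
have rc1 : inD a r c.+1 by rewrite /inD; apply: leq_ltn_trans lt_sr.
have lt_sr' : s < r.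
  rewrite ltn_neqAle sr andbT.
  by apply: contraTneq lt_sr => /val_inj->; rewrite ltnn.
by move: T4; rewrite lt_sr' lt_sr sc rc1 !enc_in // => /(_ isT).
Qed.

(** The order in column [c] excludes the first alternative of [quasi_atomic] for [s] before [r]; the
    second carries the order to column [c.+1]. *)
Lemma quasi_uncrossed (h : 'I_n -> nat -> nat) r s c :
  chains m h -> shaped (tnth a) h -> quasi_atomic (tnth a) h ->
  tnth a r < tnth a s -> r < s -> 0 < h r c -> h r c < h s c.
Proof.
move=> hC ha hQ lt_rs rs; elim: c => [|c IHc] r0.
  have s0 : 0 < h s 0 by move: r0; rewrite !ha; lia.
  by rewrite (chains_first hC r0) (chains_first hC s0) ltnS.
have r0' := leq_trans r0 (chains_decr hC r c).
have := hQ s r c; rewrite /precedes lt_rs r0' => /(_ isT isT).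
have := IHc r0'; have := chains_decr hC r c; lia.
Qed.

Lemma quasi_filling f : normalized f -> chains m (enc f) ->
  quasi_atomic (tnth a) (enc f) -> quasi_key f && first_col_rowidx f.
Proof.
move=> fN fC fQ; have [fR fD fF] := chains_enc fC; rewrite fF andbT.
have uncrossed r s c : tnth a r < tnth a s -> r < s -> inD a r c -> inD a s c ->
    ent f r c < ent f s c.
  move=> lt_rs rs rc sc.
  have := quasi_uncrossed fC (@enc_shaped f) fQ lt_rs rs (c := c).
  by rewrite !enc_in // => /(_ isT).
apply/and5P; split=> //.
- rewrite fR; apply/'forall_forallP => r c; apply/implyP => rc.
  by have := chains_row r c fC; rewrite enc_in.
- rewrite fD; apply/'forall_forallP => r s; apply/implyP => /and3P[rs r0 s0].
  move: fF => /forallP fF.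
  by rewrite (eqP (implyP (fF r) r0)) (eqP (implyP (fF s) s0)).
- apply/'forall_'forall_forallP => r s c; apply/implyP => /and4P[rs rc sc lt].
  have [le_sr|lt_rs] := leqP (tnth a s) (tnth a r); last first.
    by have := uncrossed r s c lt_rs rs rc sc; lia.
  have := fQ r s c; rewrite /precedes rs andbT eq_sym orbC -leq_eqVlt.
  rewrite enc_gt0 => /(_ le_sr sc) [|lt1]; first by rewrite !enc_in //; lia.
  have rc1 : inD a r c.+1 by rewrite -(enc_gt0 f); apply: leq_trans lt1.
  by rewrite rc1; move: lt1; rewrite !enc_in.
- apply/'forall_'forall_forallP => r s c; apply/implyP => /and4P[rs lt_rs rc sc1].
  have sc := inD_pred sc1.
  have := fQ s r c; rewrite /precedes lt_rs enc_gt0 => /(_ isT rc).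
  by have := uncrossed r s c lt_rs rs rc sc; rewrite !enc_in //; lia.
Qed.

Lemma ent_val f (r : 'I_n) (c : 'I_m) : ent f r c = f (r, c).
Proof. by rewrite /ent valK. Qed.

Lemma enc_inj f g : normalized f -> normalized g -> enc f =2 enc g -> f = g.
Proof.
move=> /forallP fN /forallP gN fg; apply/ffunP => -[r c]; apply: val_inj.
have [rc|nrc] := boolP (inD a r c).
  by have := fg r c; rewrite !enc_in // !ent_val => - [].
by rewrite (eqP (implyP (fN (r, c)) nrc)) (eqP (implyP (gN (r, c)) nrc)).
Qed.

Lemma enc_surj (h : 'I_n -> nat -> nat) : chains m h -> shaped (tnth a) h ->
  exists2 f, normalized f & enc f =2 h.
Proof.
move=> hC ha.
(* The row index is a mere default for [insubd]: [(h r c).-1] is below [n], and 0 outside the shape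
   as normalization requires. *)
pose f : filling a := [ffun rc => insubd rc.1 (h rc.1 (val rc.2)).-1].
have fE r c : f (r, c) = (h r c).-1 :> nat.
  rewrite ffunE val_insubd /=.
  by rewrite ifT //; have := chains_bound r c hC; have := ltn_ord r; lia.
exists f.
  apply/forallP => -[r c]; apply/implyP => nrc.
  rewrite [val _]fE; have := ha r c.
  by rewrite -[RHS]/(inD a r c) (negPf nrc); case: (h r c).
move=> r c; rewrite /enc /inD -ha; case: posnP => [-> //|h0].
have cm : c < m by rewrite ltnNge; apply: contraL h0 => /(chains_end hC r)->.
by rewrite (ent_val f r (Ordinal cm)) fE /= prednK.
Qed.

(** * Weights and the pairing of fillings *)

Definition entry_var (v : nat) : {mpoly int[n]} :=
  (if v is e.+1 then if insub e is Some i then 'X_i else 1 else 1)%R.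

(** Absent boxes contribute 1, so the product can run over whole columns. *)
Lemma xwt_enc f : xwt f = (\prod_(c < m) \prod_r entry_var (enc f r c))%R.
Proof.
rewrite exchange_big pair_big /xwt big_mkcond; apply: eq_bigr => -[r c] _ /=.
by rewrite /enc; case: ifP => //= _; rewrite ent_val valK.
Qed.

Definition same_col_sets f g :=
  [forall c : 'I_m, perm_eq [seq enc f r c | r <- enum 'I_n]
                            [seq enc g r c | r <- enum 'I_n]].

Lemma same_col_setsP f g : reflect (same_cols (enc f) (enc g)) (same_col_sets f g).
Proof.
apply: (iffP forallP) => [fg c|fg c]; last exact: fg.
have [mc|cm] := leqP m c; last exact: fg (Ordinal cm).
suff E h : [seq enc h r c | r <- enum 'I_n] = [seq 0 | r <- enum 'I_n] by rewrite !E.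
apply: eq_map => r; apply: enc_out; apply: contraL mc => /inD_maxpart.
by rewrite ltnNge.
Qed.

Lemma xwt_same_cols f g : same_col_sets f g -> xwt f = xwt g.
Proof.
move=> /same_col_setsP fg; rewrite !xwt_enc; apply: eq_bigr => c _.
exact: same_cols_big.
Qed.

(** [atomic_exists] controls only the columns; [shape_agree] then forces the shape [a]. *)
Lemma atom_partner g : quasi_key g && first_col_rowidx g ->
  exists f, atom_filling f && same_col_sets f g.
Proof.
move/quasi_key_enc=> [gC gQ]; have [h [hC hg hA]] := atomic_exists gC.
have ha : shaped (tnth a) h.
  move=> r c; rewrite (shape_agree hC gC hA (enc_shaped g) gQ hg).
  exact: enc_shaped.
have [f fN fh] := enc_surj hC ha; exists f; apply/andP; split.
  apply: atomic_filling => //; first exact: chains_eq2 fh hC.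
  by move=> r s c; rewrite !fh; apply: hA.
by apply/same_col_setsP => c; rewrite (eq_map (fh^~ c)).
Qed.

Lemma quasi_partner f : atom_filling f ->
  exists g, quasi_key g && first_col_rowidx g && same_col_sets f g.
Proof.
move/atom_filling_enc=> [fC fA]; have [h [hC hf hQ]] := quasi_at_exists fC.
have [b hb] := shaped_exists hC; have {}hQ := quasi_at_atomic hC hb hQ.
have ha : shaped (tnth a) h.
  move=> r c; rewrite -(shape_agree fC hC fA hb hQ (same_cols_sym hf)).
  exact: enc_shaped.
have eq_ba r : b r = tnth a r.
  have := ha r (b r); have := ha r (tnth a r); rewrite !hb; lia.
have [g gN gh] := enc_surj hC ha; exists g; apply/andP; split.
  apply: quasi_filling => //; first exact: chains_eq2 gh hC.
  move=> r s c; rewrite !gh /precedes -!eq_ba; apply: hQ.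
by apply/same_col_setsP => c; rewrite (eq_map (gh^~ c)); apply: same_cols_sym.
Qed.

Lemma atom_filling_unique f f' : atom_filling f -> atom_filling f' ->
  same_cols (enc f) (enc f') -> f = f'.
Proof.
move=> fA fA' ff'; have /andP[fN _] := fA; have /andP[fN' _] := fA'.
have [fC {}fA] := atom_filling_enc fA; have [fC' {}fA'] := atom_filling_enc fA'.
by apply: enc_inj => //; apply: atomic_unique fC fC' fA fA' ff'.
Qed.

Lemma quasi_key_unique g g' : quasi_key g && first_col_rowidx g ->
  quasi_key g' && first_col_rowidx g' -> same_cols (enc g) (enc g') -> g = g'.
Proof.
move=> gQ gQ' gg'; have /andP[/andP[gN _] _] := gQ.
have /andP[/andP[gN' _] _] := gQ'.
have [gC {}gQ] := quasi_key_enc gQ; have [gC' {}gQ'] := quasi_key_enc gQ'.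
apply: enc_inj => //.
exact: quasi_atomic_unique gC gC' (enc_shaped g) (enc_shaped g') gQ gQ' gg'.
Qed.

End Encoding.

Theorem theorem3p6 (n : nat) (a : n.-tuple nat) :
  demazure_atom a = quasikey1 a.
Proof.
pose A (f : filling a) := atom_filling f.
pose Q (g : filling a) := quasi_key g && first_col_rowidx g.
(* Sum over all pairs with equal columns: by existence and uniqueness of partners, either inner sum
   has one term. *)
transitivity (\sum_(f | A f) \sum_(g | Q g && same_col_sets f g) xwt g)%R.
  apply: eq_bigr => f fA; have [g /andP[gQ fg]] := quasi_partner fA.
  rewrite (xwt_same_cols fg) (big_pred1 g) // => g'.
  apply/andP/eqP => [[gQ' fg']|-> //]; apply: quasi_key_unique => //.
  exact: same_cols_trans (same_cols_sym (same_col_setsP _ _ fg'))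
                         (same_col_setsP _ _ fg).
rewrite (exchange_big_dep Q) => [|f g _ /andP[] //]; apply: eq_bigr => g gQ /=.
have [f /andP[fA fg]] := atom_partner gQ.
rewrite (big_pred1 f) // => f'; rewrite gQ.
apply/andP/eqP => [[fA' fg']|-> //]; apply: atom_filling_unique => //.
exact: same_cols_trans (same_col_setsP _ _ fg')
                       (same_cols_sym (same_col_setsP _ _ fg)).
Qed.
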